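(* For any fixed integers $n\ge 0$ and $l\ge 0$, the sequence $$\binom{n}{l}\binom{n}{0},\ \binom{n}{l-1}\binom{n}{1},\ \ldots,\ \binom{n}{0}\binom{n}{l},$$ i.e. the sequence $\left(\binom{n}{l-k}\binom{n}{k}\right)_{k=0}^{l}$, is unimodal.
   Context: Binomial coefficients $\binom{n}{m}$ are interpreted as $0$ when $m<0$ or $m>n$. A sequence of real numbers $(a_k)_{k\ge 0}$ is unimodal if there is an index $m$ such that $a_0\le a_1\le\cdots\le a_m\ge a_{m+1}\ge\cdots$. *)

(* Defs.v *)
From mathcomp Require Import all_boot all_order all_algebra.
Import Order.TTheory GRing.Theory Num.Theory.
Local Open Scope ring_scope.

(* The finite sequence a 0, ..., a l (l included); values of a beyond l are
   irrelevant. *)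
Definition unimodal (R : realFieldType) (l : nat) (a : nat -> R) : Prop :=
  exists m : nat,
    [/\ (m <= l)%N,
        forall k : nat, (k < m)%N -> a k <= a k.+1
      & forall k : nat, (m <= k)%N -> (k < l)%N -> a k.+1 <= a k].

(* Main.v *)
Require Import Defs.
From mathcomp Require Import all_boot all_order all_algebra.
From mathcomp Require Import zify.
Local Open Scope ring_scope.

(** The sequence is symmetric under [k |-> l - k], and by log-concavity of
    [k |-> 'C(n, k)] a product ['C(n, i) * 'C(n, j)] with [i + j] fixed grows
    as [i] and [j] get closer; hence the mode is at [l./2]. *)

Lemma leq_bin_mul_log_concave (n i j : nat) : (i <= j)%N ->
  ('C(n, i) * 'C(n, j.+1) <= 'C(n, i.+1) * 'C(n, j))%N.
Proof.
(* After scaling by [(i+1)(j+1)], the absorption identity [mul_bin_left] brings out the common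
   factor ['C(n, i) * 'C(n, j)]. *)
move=> le_ij; rewrite -(leq_pmul2l (ltn0Sn i)) -(leq_pmul2l (ltn0Sn j)).
rewrite [X in (X <= _)%N](_ : _ = i.+1 * 'C(n, i) * (j.+1 * 'C(n, j.+1)))%N;
  last by lia.
rewrite [X in (_ <= X)%N](_ : _ = j.+1 * 'C(n, j) * (i.+1 * 'C(n, i.+1)))%N;
  last by lia.
rewrite !mul_bin_left mulnACA [leqRHS]mulnACA [('C(n, j) * _)%N]mulnC.
(* What remains is [(i+1)(n-j) <= (j+1)(n-i)], true factor by factor; truncated subtraction covers
   [j > n]. *)
by rewrite leq_mul2r leq_mul ?orbT // leq_sub2l.
Qed.

Theorem theorem3p2 (R : realFieldType) (n l : nat) :
  @unimodal R l (fun k : nat => 'C(n, l - k)%:R * 'C(n, k)%:R).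
Proof.
exists l./2; split=> [|k lt_k|k le_k lt_kl]; first by lia.
- rewrite -!GRing.natrM Num.Theory.ler_nat.
  have -> : (l - k)%N = (l - k.+1).+1 by lia.
  (* Left of the middle the smaller index is [k]: take [i = k], [j = l-k-1]. *)
  rewrite mulnC [leqRHS]mulnC.
  by apply: leq_bin_mul_log_concave; lia.
- rewrite -!GRing.natrM Num.Theory.ler_nat.
  have -> : (l - k)%N = (l - k.+1).+1 by lia.
  (* Now the roles swap: [i = l-k-1], [j = k]. For odd [l] and [k = l./2] they coincide, a tie. *)
  by apply: leq_bin_mul_log_concave; lia.
Qed.
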